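(* Let $A$ be a finite, non-empty subset of an abelian group $G$. Suppose that $|A|\le |G|/2$. Then there exists a finite subgroup $H<G$ satisfying $|A+H|-|A|\le |H|-1$ and $A+H\neq G$, and such that $\varphi_{G/H}(A)$ is either an arithmetic progression in $G/H$ or a thick component of $G/H$.
   Context: Groups are abelian and written additively, and $G$ may be infinite (in which case $|A|\le|G|/2$ holds automatically); $A+B:=\{a+b: a\in A,\ b\in B\}$. For a subgroup $H\le G$, $\varphi_{G/H}:G\to G/H$ denotes the canonical homomorphism. An arithmetic progression in an abelian group $G$ with difference $d\in G$ is a set of the form $\{g+d,g+2d,\ldots,g+kd\}$ with $g\in G$ and $k$ a positive integer not exceeding the order of $d$ in $G$ (so one-element sets and cosets of finite cyclic subgroups are arithmetic progressions; the empty set is not). A non-empty, finite subset $A$ of an abelian group $G$ is a thick component of $G$ if for any finite subset $B\subseteq G$ with $|B|\ge 2$ either $|A+B|\ge |A|+|B|$, or $|A|+|B|\ge |G|-1$ (or both) hold. *)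

(* Defs.v *)
From HB Require Import structures.
From mathcomp Require Import all_boot all_order all_algebra.
From mathcomp Require Import finmap.
From mathcomp Require Import mathcomp_extra boolp classical_sets functions cardinality.

Set Implicit Arguments.
Unset Strict Implicit.
Unset Printing Implicit Defensive.

Import GRing.Theory.
Local Open Scope fset_scope.
Local Open Scope ring_scope.
Local Open Scope card_scope.

Definition sumset (G : zmodType) (A B : {fset G}) : {fset G} :=
  [fset a + b | a in A, b in B].

Definition quot_image (G : zmodType) (H : zmodClosed G) (A : {fset G}) :
    {fset Quotient.quot H} :=
  [fset \pi_(Quotient.quot H)%qT a | a in A].

(* The order of d is the least positive n with d *+ n = 0, and is infinite when
   there is none; k does not exceed it when k is at most every such n. *)
Definition le_order (G : zmodType) (k : nat) (d : G) : Prop :=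
  forall n : nat, (0 < n)%N -> d *+ n = 0 -> (k <= n)%N.

Definition arithmetic_progression (G : zmodType) (A : {fset G}) : Prop :=
  exists (g d : G) (k : nat),
    [/\ (0 < k)%N, le_order k d & A = [fset g + d *+ i | i in iota 1 k]].

(* Since A is non-empty, |A| + |B| >= |G| - 1 is |G| <= |A| + |B| + 1, which is
   false when G is infinite. *)
Definition thick_component (G : zmodType) (A : {fset G}) : Prop :=
  A != fset0 /\
  forall B : {fset G}, (2 <= #|` B|)%N ->
    (#|` A| + #|` B| <= #|` sumset A B|)%N \/
    [set: G]%classic #<= `I_(#|` A| + #|` B| + 1)%classic.

(* Main.v *)
From HB Require Import structures.
Require Import Defs.
From mathcomp Require Import all_boot all_order all_algebra.
From mathcomp Require Import finmap mathcomp_extra boolp classical_sets functions cardinality.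
From mathcomp Require Import zify.

Set Implicit Arguments.
Unset Strict Implicit.
Unset Printing Implicit Defensive.

Import GRing.Theory.
Local Open Scope fset_scope.
Local Open Scope ring_scope.
Local Open Scope card_scope.

(** Hamidoune's isoperimetric method proves the statement without Kemperman's
    structure theorem.

    Call a finite subgroup [K] tight for [A] if [|A + K| < |A| + |K|] and
    [A + K] is not the whole group.  The trivial subgroup is tight, and if [A]
    meets more than one coset of a tight [K] then [2 |K| <= |A + K|], so that
    [|K| < |A|].  Hence either the image of [A] modulo some tight subgroup is
    a single point, which is a progression, or a tight [K] of maximal size
    exists.  If the image of [A] modulo that [K] were neither a progression
    nor a thick component, [critical_pair] would give a tight subgroup with at
    least two elements for this image, whose preimage is tight for [A] and
    larger than [K] ([tight_fiber]).

    It remains to prove [critical_pair]: if [S] has at most [(|G| + 1) / 2]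
    elements and [|S + B| < |S| + |B| <= |G| - 2] for some [B] with at least
    two elements, then [S] is a progression or has a nontrivial tight
    subgroup.  Among the [X] with [|X| >= 2] whose sumset [X + S] misses at
    least two elements, take one, [M], that minimizes [|X + S| - |X|], and of
    least size among these: a 2-atom.  By submodularity of [X |-> |X + S|],
    distinct translates of [M] meet in at most one element ([atom_exists]).
    So, once translated to contain 0, [M] is a subgroup or a Sidon set.

    - If [M] is a subgroup, it is tight for [S].
    - If [M = {0, d}], then [S + d] has at most one element outside [S], so
      [S] is a union of [<d>]-cosets together with at most one progression of
      difference [d] ([pair_atom]).
    - If [M] is a Sidon set with at least three elements, let [N] be a 2-atom
      of [M].  Two Sidon sets have a large sumset ([sidon_sumset]), so [N] is
      a finite subgroup; since a Sidon set cannot nearly fill two cosets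
      ([sidon_sub_subgroup]), [M] lies in [N].  For the least subgroup [K]
      containing [M], the sets [X + M] with [X] in [K] grow as fast as in the
      integers until they fill [K] ([sidon_sumset_minimal], which uses
      1-atoms).  Therefore [S] is [K]-periodic apart from one coset, and [K]
      is tight ([sidon_atom]). *)

(** * Sumsets and translates *)

Definition translate (G : zmodType) (A : {fset G}) (x : G) : {fset G} :=
  [fset a + x | a in A].

Section Sumsets.
Variable G : zmodType.
Implicit Types (A B C S T X Y : {fset G}) (x y a b : G).

Lemma sumsetP A B x :
  reflect (exists2 a, a \in A & exists2 b, b \in B & x = a + b)
          (x \in sumset A B).
Proof.
apply: (iffP (imfset2P _ _ _ _ _)) => /= -[a aA [b bB ->]];
  by exists a => //; exists b.
Qed.

Lemma mem_sumset A B a b : a \in A -> b \in B -> a + b \in sumset A B.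
Proof. by move=> aA bB; apply/sumsetP; exists a => //; exists b. Qed.

Lemma sumsetC A B : sumset A B = sumset B A.
Proof.
apply/fsetP=> x; apply/sumsetP/sumsetP=> -[a aA [b bB ->]];
  by exists b => //; exists a => //; rewrite addrC.
Qed.

Lemma sumsetSl A B S : A `<=` B -> sumset A S `<=` sumset B S.
Proof.
move=> /fsubsetP sAB; apply/fsubsetP=> _ /sumsetP[a aA [s sS ->]].
by apply: mem_sumset => //; apply: sAB.
Qed.

Lemma sumsetUl A B S : sumset (A `|` B) S = sumset A S `|` sumset B S.
Proof.
apply/fsetP=> x; rewrite inE; apply/sumsetP/orP.
  by case=> a; rewrite inE => /orP[aA|aB] [s sS ->]; [left|right];
    apply: mem_sumset.
by case=> /sumsetP[a aA [s sS ->]]; exists a; rewrite ?inE ?aA ?orbT //;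
  exists s.
Qed.

Lemma in_translate A x y : (y \in translate A x) = (y - x \in A).
Proof.
apply/imfsetP/idP => /= [[a aA ->]|yxA]; first by rewrite addrK.
by exists (y - x); rewrite ?subrK.
Qed.

Lemma card_translate A x : #|` translate A x| = #|` A|.
Proof. by apply: card_imfset; apply: addIr. Qed.

Lemma sumset_translate A B x :
  sumset (translate A x) B = translate (sumset A B) x.
Proof.
apply/fsetP=> y; rewrite in_translate; apply/sumsetP/sumsetP.
  case=> a; rewrite in_translate => aA [b bB ->].
  by exists (a - x) => //; exists b => //; rewrite addrAC.
case=> a aA [b bB e]; exists (a + x); first by rewrite in_translate addrK.
by exists b => //; rewrite addrAC -e subrK.
Qed.

Lemma card_sumset_translate A B x :
  #|` sumset (translate A x) B| = #|` sumset A B|.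
Proof. by rewrite sumset_translate card_translate. Qed.

Lemma translate_sub A B b : b \in B -> translate A b `<=` sumset A B.
Proof.
move=> bB; apply/fsubsetP=> y; rewrite in_translate => yA.
by rewrite -(subrK b y); apply: mem_sumset.
Qed.

Lemma card_sumset_ge A B : B != fset0 -> (#|` A| <= #|` sumset A B|)%N.
Proof.
case/fset0Pn=> b bB; rewrite -(card_translate A b).
exact/fsubset_leq_card/translate_sub.
Qed.

(** The only property of sumsets behind the intersection property of atoms. *)
Lemma submodular_sumset X Y S :
  (#|` sumset (X `&` Y) S| + #|` sumset (X `|` Y) S| <=
   #|` sumset X S| + #|` sumset Y S|)%N.
Proof.
rewrite sumsetUl -[leqRHS]cardfsUI addnC leq_add2l.
by apply/fsubset_leq_card/fsubsetIP; split; apply: sumsetSl;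
  [apply: fsubsetIl | apply: fsubsetIr].
Qed.

End Sumsets.

(** * Lower bounds on the size of a possibly infinite set *)

Section Size.
Variable G : zmodType.
Implicit Types (U : {pred G}) (X : {fset G}).

(** The size comparison [n <= |U|] in a form that makes sense for infinite [U]
    as well. *)
Definition at_least U n :=
  exists2 X : {fset G}, {subset X <= U} & (n <= #|` X|)%N.

Lemma at_leastW U m n : (m <= n)%N -> at_least U n -> at_least U m.
Proof. by move=> mn [X XU nX]; exists X => //; apply: leq_trans nX. Qed.

Lemma at_leastN U n : ~ at_least U n ->
  exists2 W : {fset G}, W =i U & (#|` W| < n)%N.
Proof.
move=> nU.
pose P k := `[< at_least U k >].
have exP : exists k, P k.
  by exists 0%N; apply/asboolP; exists fset0.
have ubP k : P k -> (k <= n)%N.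
  move=> /asboolP Uk; rewrite leqNgt; apply/negP=> nk; apply: nU.
  exact: at_leastW (ltnW nk) Uk.
case: (ex_maxnP exP ubP) => k /asboolP[W WU kW] kmax.
have Wn : (#|` W| < n)%N.
  by rewrite ltnNge; apply/negP=> nW; apply: nU; exists W.
exists W => // x; apply/idP/idP; first exact: WU.
move=> xU; apply: contraT => xW.
have : P (#|` x |` W|).
  apply/asboolP; exists (x |` W) => // y.
  by rewrite !inE => /orP[/eqP->//|]; apply: WU.
by move/kmax; rewrite cardfsU1 xW; lia.
Qed.

Lemma at_least_out n X : at_least predT n -> (#|` X| < n)%N ->
  exists x, x \notin X.
Proof.
move=> [Y _ nY] Xn; apply: contrapT => h.
have : Y `<=` X.
  by apply/fsubsetP=> y _; apply: contraT => yX; case: h; exists y.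
by move/fsubset_leq_card; lia.
Qed.

End Size.

(** * Atoms of the isoperimetric problem *)

Section Atoms.
Variables (G : zmodType) (U : {pred G}) (S : {fset G}) (r : nat).
Implicit Types (X Y M : {fset G}).

(** The competitors of the [r]-th isoperimetric problem for [S] in the ambient
    group [U]: the complement of [X + S] keeps at least [r] elements.  The
    ambient group is a parameter because the problem is solved both in the
    whole group and inside a finite subgroup of it. *)
Definition separating X :=
  [/\ {subset X <= U}, (r <= #|` X|)%N & at_least U (#|` sumset X S| + r)].

Hypothesis Uz : zmod_closed U.
Hypothesis SU : {subset S <= U}.
Hypothesis S0 : S != fset0.

Lemma closedN x : x \in U -> - x \in U.
Proof. by case: Uz => U0 UB xU; rewrite -sub0r; apply: UB. Qed.

Lemma closedD x y : x \in U -> y \in U -> x + y \in U.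
Proof. by case: Uz => _ UB xU yU; rewrite -(opprK y); apply/UB/closedN. Qed.

Lemma separating_translate X x : x \in U -> separating X ->
  separating (translate X x).
Proof.
move=> xU [XU rX bX]; split; rewrite ?card_translate ?card_sumset_translate //.
move=> y; rewrite in_translate => /XU yU; rewrite -(subrK x y).
exact: closedD.
Qed.

(** Duality: if [U] is finite, the negative [Y] of the complement of [X + S] is
    again separating, since [Y + S] avoids [- X]; and [|Y + S| - |Y|] is at
    most [|X + S| - |X|].  When [Y] is smaller than [X], an atom [X] cannot
    allow this. *)
Lemma separating_dual X : separating X ->
  ~ at_least U (#|` sumset X S| + #|` X|) ->
  exists2 Y, separating Y &
    (#|` Y| < #|` X|)%N /\
    (#|` sumset Y S| + #|` X| <= #|` Y| + #|` sumset X S|)%N.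
Proof.
move=> [XU rX bX] /at_leastN[W WU cW].
have XSW : sumset X S `<=` W.
  apply/fsubsetP=> _ /sumsetP[x /XU xX [s /SU sS ->]].
  by rewrite WU closedD.
have XW : X `<=` W by apply/fsubsetP=> x /XU; rewrite WU.
pose D := [fset - w | w in W `\` sumset X S].
have DP y : (y \in D) = (- y \in W `\` sumset X S).
  apply/imfsetP/idP=> [[w wW ->]|yW]; first by rewrite opprK.
  by exists (- y); rewrite ?opprK.
have cD : #|` D| = (#|` W| - #|` sumset X S|)%N.
  rewrite card_imfset /=; last exact: oppr_inj.
  by rewrite cardfsD (fsetIidPr XSW).
have cDS : (#|` sumset D S| <= #|` W| - #|` X|)%N.
  pose Z := [fset - w | w in W `\` X].
  have -> : (#|` W| - #|` X| = #|` Z|)%N.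
    rewrite card_imfset /=; last exact: oppr_inj.
    by rewrite cardfsD (fsetIidPr XW).
  apply: fsubset_leq_card; apply/fsubsetP=> _ /sumsetP[y yD [s sS ->]].
  apply/imfsetP; exists (- (y + s)); rewrite ?opprK //=.
  move: yD; rewrite DP !in_fsetD !WU opprD => /andP[yXS yU].
  apply/andP; split; last first.
    by apply: closedD => //; apply/closedN/SU.
  apply: contra yXS => ysX; rewrite -(subrK s (- y)).
  exact: mem_sumset.
have := fsubset_leq_card XSW; have := fsubset_leq_card XW.
have bW : (#|` sumset X S| + r <= #|` W|)%N.
  case: bX => Y YU /leq_trans; apply; apply: fsubset_leq_card.
  by apply/fsubsetP=> y /YU; rewrite WU.
move=> cXW cXSW; exists D; last by rewrite cD; split; lia.
split; [|by rewrite cD; lia|].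
- move=> y; rewrite DP in_fsetD WU => /andP[_ /closedN].
  by rewrite opprK.
- exists W; first by move=> w wW; rewrite -WU.
  by lia.
Qed.

(** An atom minimizes the defect [|X + S| - |X|], and then [|X|], over the
    separating sets.  If two distinct translates [M] and [N] of an atom met in
    [r] or more elements, [M `&` N] would be separating and smaller, hence of
    larger defect, and by submodularity [M `|` N] would have smaller defect.
    That contradicts minimality provided that [M `|` N] is separating, which
    holds because the complement of [M + S] has at least [|M|] elements, by
    duality. *)
Lemma atom_exists c B : (0 < r)%N -> separating B ->
  (#|` sumset B S| <= #|` B| + c)%N ->
  exists M, [/\ separating M, 0 \in M, (#|` sumset M S| <= #|` M| + c)%N &
    forall x, x \in U ->
      translate M x = M \/ (#|` M `&` translate M x| < r)%N].
Proof.
move=> r0 sB cB.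
pose defect X := (#|` sumset X S| - #|` X|)%N.
have defectE X : #|` sumset X S| = (#|` X| + defect X)%N.
  by rewrite subnKC // card_sumset_ge.
pose P k := `[< exists2 X, separating X & defect X = k >].
have exP : exists k, P k by exists (defect B); apply/asboolP; exists B.
case: (ex_minnP exP) => k /asboolP[X0 sX0 dX0] kmin.
pose Q n := `[< exists X, [/\ separating X, defect X = k & #|` X| = n] >].
have exQ : exists n, Q n by exists #|` X0|; apply/asboolP; exists X0.
case: (ex_minnP exQ) => m /asboolP[M1 [sM1 dM1 cM1]] mmin.
have kmin' X : separating X -> (k <= defect X)%N.
  by move=> sX; apply: kmin; apply/asboolP; exists X.
have mmin' X : separating X -> (#|` X| < m)%N -> (k < defect X)%N.
  move=> sX Xm; rewrite ltn_neqAle kmin' // andbT; apply/eqP=> e.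
  suff /mmin : Q #|` X| by lia.
  by apply/asboolP; exists X.
have [x0 x0M1] : exists x, x \in M1.
  by apply/fset0Pn; rewrite -cardfs_gt0; case: sM1 => _ + _; apply: leq_trans.
have x0U : x0 \in U by case: sM1 => /(_ _ x0M1).
pose M := translate M1 (- x0).
have sM : separating M by apply: separating_translate => //; apply: closedN.
have cM : #|` M| = m by rewrite card_translate.
have dM : defect M = k.
  by rewrite /defect /M card_sumset_translate card_translate.
exists M; split => //.
- by rewrite in_translate opprK add0r.
- rewrite defectE dM leq_add2l; apply: leq_trans (kmin' _ sB) _.
  by rewrite /defect; lia.
move=> x xU; have [->|/eqP Mx] := eqVneq (translate M x) M; [by left|right].
set N := translate M x in Mx *.
have sN : separating N by apply: separating_translate.
have cN : #|` N| = m by rewrite card_translate.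
have dN : defect N = k by rewrite /defect card_sumset_translate card_translate.
rewrite ltnNge; apply/negP=> rI.
have cI : (#|` M `&` N| < m)%N.
  rewrite -cM; apply: fproper_ltn_card; rewrite fproperE fsubsetIl /=.
  apply/negP=> /fsubsetIP[_ MN]; apply: Mx; apply/esym/eqP.
  by rewrite eqEfcard MN cM cN leqnn.
(* Otherwise the dual of M would be a separating set smaller than M. *)
have bMm : at_least U (#|` sumset M S| + m).
  apply: contrapT => nb; rewrite -cM in nb.
  have [Y sY [cY dY]] := separating_dual sM nb.
  have := mmin' Y sY; rewrite cM in cY dY; rewrite cY => /(_ isT).
  have := defectE Y; have := defectE M; rewrite dM cM; lia.
have sI : separating (M `&` N).
  split=> // [y|]; first by rewrite inE => /andP[yM _]; case: sM => /(_ _ yM).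
  case: sM => _ _; apply: at_leastW; rewrite leq_add2r.
  exact/fsubset_leq_card/sumsetSl/fsubsetIl.
have dI := mmin' _ sI cI.
have sub := submodular_sumset M N S.
have := cardfsUI M N; rewrite !defectE cM cN dM dN in sub * => cUI.
have sU : separating (M `|` N).
  split.
  - move=> y; rewrite inE => /orP[]; first by case: sM => + _ _; apply.
    by case: sN => + _ _; apply.
  - case: sM => _ rM _; lia.
  - apply: at_leastW bMm; rewrite !defectE dM cM; lia.
have := kmin' _ sU; lia.
Qed.

End Atoms.

(** * Finite subgroups and Sidon sets *)

Section Subgroups.
Variable G : zmodType.
Implicit Types (A B C K L M N Q S T : {fset G}) (x y d : G).

Definition subgroup K := 0 \in K /\ {in K &, forall x y, x - y \in K}.

Lemma subgroupN K x : subgroup K -> x \in K -> - x \in K.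
Proof. by move=> sK; exact: (@closedN G (mem K) sK x). Qed.

Lemma subgroupD K x y : subgroup K -> x \in K -> y \in K -> x + y \in K.
Proof. by move=> sK; exact: (@closedD G (mem K) sK x y). Qed.

Lemma subgroup_stab M :
  0 \in M -> {in M, forall y, translate M y = M} -> subgroup M.
Proof. by move=> M0 stM; split=> // x y xM yM; rewrite -in_translate stM. Qed.

Definition sidon M := forall x, x != 0 -> (#|` M `&` translate M x| <= 1)%N.

(** Translates of a 1-atom are equal or disjoint, so a 1-atom containing 0 is a
    subgroup. *)
Lemma one_atom_exists (U : {pred G}) S c B :
  zmod_closed U -> {subset S <= U} -> S != fset0 -> separating U S 1 B ->
  (#|` sumset B S| <= #|` B| + c)%N ->
  exists M, [/\ separating U S 1 M, (#|` sumset M S| <= #|` M| + c)%N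
    & subgroup M].
Proof.
move=> Uz SU S0 sB cB.
have [M [sM M0 cM dich]] := atom_exists Uz SU S0 (ltn0Sn 0) sB cB.
exists M; split=> //; apply: subgroup_stab => // y yM.
case: (dich y) => //; first by case: sM => + _ _; apply.
rewrite ltnS leqn0 cardfs_eq0 => /eqP/fsetP/(_ y).
by rewrite !inE in_translate subrr M0 yM.
Qed.

(** If a 2-atom [M] containing 0 has a period [x != 0], then for every [y] in
    [M] the translate [M + y] shares both [y] and [y + x] with [M], hence equals
    [M]: a 2-atom with a period is a subgroup, and one without is Sidon. *)
Lemma two_atom_exists S c B :
  S != fset0 -> separating predT S 2 B ->
  (#|` sumset B S| <= #|` B| + c)%N ->
  exists M, [/\ separating predT S 2 M, 0 \in M,
    (#|` sumset M S| <= #|` M| + c)%N & subgroup M \/ sidon M].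
Proof.
move=> S0 sB cB.
have Uz : zmod_closed (predT : {pred G}) by [].
have [//|M [sM M0 cM dich]] := atom_exists Uz _ S0 (ltn0Sn 1) sB cB.
exists M; split=> //.
have [[x x0 Mx]|nst] := pselect (exists2 x, x != 0 & translate M x = M).
  left; apply: subgroup_stab => // y yM.
  case: (dich y) => // cI.
  have yI : y \in M `&` translate M y by rewrite inE in_translate subrr M0 yM.
  have yxI : y + x \in M `&` translate M y.
    by rewrite inE in_translate -{1}Mx in_translate addrK yM addrAC subrr add0r
      -Mx in_translate subrr M0.
  have /fsubset_leq_card : [fset y; y + x] `<=` M `&` translate M y.
    by apply/fsubsetP=> z; rewrite in_fset2 => /orP[] /eqP->.
  have yx : y != y + x by rewrite -{1}(addr0 y) (inj_eq (addrI y)) eq_sym.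
  by rewrite cardfs2 yx => /leq_ltn_trans/(_ cI).
right=> x x0; case: (dich x) => // Mx; first by case: nst; exists x.
Qed.

Lemma card_translateI M x y :
  #|` translate M x `&` translate M y| = #|` M `&` translate M (y - x)|.
Proof.
rewrite -[RHS](card_translate _ x); congr #|` _|; apply/fsetP=> z.
by rewrite !(in_translate, inE) opprB addrA subrK.
Qed.

Lemma sidonI M x y : sidon M -> x != y ->
  (#|` translate M x `&` translate M y| <= 1)%N.
Proof. by move=> sM xy; rewrite card_translateI sM // subr_eq0 eq_sym. Qed.

Lemma card_gt_pick N k : (k < #|` N|)%N ->
  exists2 x, x \in N & (k <= #|` N `\ x|)%N.
Proof.
move=> kN; have /fset0Pn[x xN] : N != fset0 by rewrite -cardfs_gt0; lia.
by exists x => //; move: kN; rewrite (cardfsD1 x) xN.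
Qed.

Lemma sidon_sumset2 M N : sidon M -> (2 <= #|` N|)%N ->
  (2 * #|` M| <= #|` sumset M N| + 1)%N.
Proof.
move=> sM /card_gt_pick[x xN /card_gt_pick[y]]; rewrite !inE => /andP[yx yN] _.
have := sidonI sM yx; have := cardfsUI (translate M y) (translate M x).
rewrite !card_translate.
have /fsubset_leq_card : translate M y `|` translate M x `<=` sumset M N.
  by rewrite fsubUset !translate_sub.
by lia.
Qed.

Lemma sidon_sumset3 M N : sidon M -> (3 <= #|` N|)%N ->
  (3 * #|` M| <= #|` sumset M N| + 3)%N.
Proof.
move=> sM /card_gt_pick[x xN /card_gt_pick[y + /card_gt_pick[z + _]]].
rewrite !inE => /andP[yx yN] /andP[zy /andP[zx zN]].
have := sidonI sM yx; have := cardfsUI (translate M y) (translate M x).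
have := cardfsUI (translate M z) (translate M y `|` translate M x).
rewrite fsetIUr; have := sidonI sM zx; have := sidonI sM zy.
have := cardfsUI (translate M z `&` translate M y)
  (translate M z `&` translate M x).
rewrite !card_translate.
have /fsubset_leq_card : translate M z `|` (translate M y `|` translate M x)
    `<=` sumset M N.
  by rewrite !fsubUset !translate_sub.
by lia.
Qed.

(** If [|N| = 2], the two translates of [M] overlap in at most one element.
    Otherwise [|N| <= |M|] can be assumed by symmetry, and three translates of
    [M] already have at least [3 |M| - 3] elements in their union. *)
Lemma sidon_sumset M N : sidon M -> sidon N ->
  (3 <= #|` M|)%N -> (2 <= #|` N|)%N ->
  (#|` M| + #|` N| <= #|` sumset M N|)%N.
Proof.
move=> sM sN M3 N2; have := sidon_sumset2 sM N2.
have [->|N2'] := eqVneq #|` N| 2; first by lia.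
have N3 : (3 <= #|` N|)%N by rewrite ltn_neqAle eq_sym N2'.
have := sidon_sumset3 sM N3; have := sidon_sumset3 sN M3.
by rewrite (sumsetC N M); lia.
Qed.

(** If [M] met two cosets of [Q], then [|M + Q| >= 2 |Q|], and for any nonzero
    [x] in [Q] the sets [M] and [M + x] would both lie in [M + Q] and fill more
    than half of it, overlapping in at least two elements. *)
Lemma sidon_sub_subgroup M Q : sidon M -> 0 \in M -> subgroup Q ->
  (2 <= #|` Q|)%N -> (#|` sumset M Q| < #|` M| + #|` Q|)%N -> M `<=` Q.
Proof.
move=> sM M0 sQ Q2 cMQ; apply/fsubsetP=> m mM; apply: contraT => mQ.
have [Q0 QB] := sQ.
have [x] : exists x, x \in Q `\ 0.
  apply/fset0Pn; rewrite -cardfs_gt0.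
  by move: Q2; rewrite (cardfsD1 0) Q0.
rewrite !inE => /andP[x0 xQ].
have dis : Q `&` translate Q m = fset0.
  apply/fsetP=> y; rewrite !inE in_translate; apply/negP=> /andP[yQ ymQ].
  by have := QB _ _ yQ ymQ; rewrite opprB addrC subrK (negPf mQ).
have := cardfsUI Q (translate Q m).
rewrite dis cardfs0 card_translate.
have /fsubset_leq_card : Q `|` translate Q m `<=` sumset M Q.
  rewrite sumsetC fsubUset translate_sub // andbT; apply/fsubsetP=> y yQ.
  by rewrite -(addr0 y); apply: mem_sumset.
have := sM x x0; have := cardfsUI M (translate M x); rewrite card_translate.
have /fsubset_leq_card : M `|` translate M x `<=` sumset M Q.
  rewrite fsubUset translate_sub // andbT; apply/fsubsetP=> y yQ.
  by rewrite -(addr0 y); apply: mem_sumset.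
by lia.
Qed.

(** A counterexample [T] makes a 1-atom of [M] in [K] a subgroup [Q] with
    [|Q + M| <= |Q| + |M| - 2] and [Q + M != K].  By [sidon_sub_subgroup] it
    contains [M], and it is smaller than [K], against the choice of [K]. *)
Lemma sidon_sumset_minimal M K T :
  sidon M -> 0 \in M -> (2 <= #|` M|)%N -> subgroup K -> M `<=` K ->
  (forall Q, subgroup Q -> M `<=` Q -> (#|` K| <= #|` Q|)%N) ->
  T != fset0 -> T `<=` K -> ~~ (K `<=` sumset T M) ->
  (#|` T| + #|` M| <= #|` sumset T M| + 1)%N.
Proof.
move=> sM M0 M2 sK /fsubsetP MK Kmin T0 /fsubsetP TK TMK.
rewrite leqNgt; apply/negP=> cTM.
have cK : (#|` sumset T M| < #|` K|)%N.
  apply: fproper_ltn_card; rewrite fproperE TMK andbT.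
  apply/fsubsetP=> _ /sumsetP[t /TK tK [m /MK mK ->]].
  exact: subgroupD.
have sT : separating (mem K) M 1 T.
  split; [exact: TK | by rewrite cardfs_gt0 | exists K => //].
  by rewrite addn1.
have nM : M != fset0 by apply/fset0Pn; exists 0.
have [|Q [[QK _ bQ] cQ sQ]] := @one_atom_exists (mem K) M (#|` M| - 2) T
  sK MK nM sT; first by lia.
have nQ : Q != fset0 by apply/fset0Pn; exists 0; case: sQ.
have := card_sumset_ge M nQ; rewrite sumsetC => cQ1.
have /(Kmin Q sQ) : M `<=` Q.
  by apply: sidon_sub_subgroup => //; rewrite 1?sumsetC; lia.
case: bQ => X XK; have /fsubset_leq_card : X `<=` K.
  by apply/fsubsetP=> y /XK.
by have := card_sumset_ge Q nM; lia.
Qed.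

(** The periods [L] of [S] minus a part [C] of a single coset of [L] are what
    both remaining types of atoms produce.  The bound [|S| <= (|G| + 1) / 2] is
    needed to keep [S + L] from being everything: [|S + L|] is at most
    [|S `\` C| + |L|], hence at most [2 |S `\` C| <= 2 |S| - 2], as soon as
    [S `\` C] contains a full coset of [L]. *)
Lemma almost_periodic L S C c :
  subgroup L -> C `<=` S -> C != fset0 -> {in C, forall y, y - c \in L} ->
  {in L, forall x, translate (S `\` C) x = S `\` C} ->
  (#|` sumset S L| < #|` S| + #|` L|)%N /\
  (S `\` C != fset0 -> at_least (predT : {pred G}) (2 * #|` S| - 1) ->
    exists x, x \notin sumset S L).
Proof.
move=> sL CS C0 Cc per.
have := cardfsD S C; rewrite (fsetIidPr CS) => cD.
have cC := fsubset_leq_card CS.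
have C1 : (0 < #|` C|)%N by rewrite cardfs_gt0.
have : sumset S L `<=` (S `\` C) `|` translate L c.
  apply/fsubsetP=> _ /sumsetP[s sS [l lL ->]]; rewrite inE in_translate.
  have [sC|sC] := boolP (s \in C).
    by rewrite addrAC (subgroupD sL _ lL) ?orbT ?Cc.
  by rewrite -(per l lL) in_translate addrK inE sC sS.
move=> /fsubset_leq_card; have := cardfsUI (S `\` C) (translate L c).
rewrite card_translate => cUI cSL; split; first by lia.
case/fset0Pn=> s sD G2; apply: at_least_out G2 _.
have : translate L s `<=` S `\` C.
  apply/fsubsetP=> y; rewrite in_translate => /per <-.
  by rewrite in_translate opprB addrC subrK.
by move/fsubset_leq_card; rewrite card_translate; lia.
Qed.

End Subgroups.

(** * Sets with a small sumset *)

Section CriticalPair.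
Variable G : zmodType.
Implicit Types (A B C K L M N Q S T : {fset G}) (x y d : G).

Definition tight_subgroup S L :=
  [/\ subgroup L, (#|` sumset S L| < #|` S| + #|` L|)%N
    & exists x, x \notin sumset S L].

Lemma pigeonhole S (f : nat -> G) :
  (forall i, (i <= #|` S|)%N -> f i \in S) ->
  exists i j, [/\ (i < j)%N, (j <= #|` S|)%N & f i = f j].
Proof.
move=> fS; pose s := map f (iota 0 #|` S|.+1).
have ss : size s = #|` S|.+1 by rewrite size_map size_iota.
have /(uniqPn 0)[i [j [ij js]]] : ~~ uniq s.
  apply/negP=> us; have /(uniq_leq_size us) : {subset s <= S}.
    by move=> _ /mapP[i + ->]; rewrite mem_iota => /andP[_]; apply: fS.
  by rewrite ss ltnn.
rewrite ss in js; have iS := ltn_trans ij js.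
rewrite !(nth_map 0%N) ?size_iota // !nth_iota // !add0n => e.
by exists i, j.
Qed.

Lemma cyclic_subgroup d n : (0 < n)%N -> d *+ n = 0 ->
  exists2 L : {fset G}, subgroup L &
    forall x, x \in L <-> exists i, x = d *+ i.
Proof.
move=> n0 dn; pose L := [fset d *+ i | i in iota 0 n].
have LP x : reflect (exists i, x = d *+ i) (x \in L).
  apply: (iffP (imfsetP _ _ _ _)) => /= [[i _ ->]|[i ->]]; first by exists i.
  exists (i %% n)%N; first by rewrite mem_iota ltn_mod.
  by rewrite {1}(divn_eq i n) mulrnDr mulnC mulrnA dn mul0rn add0r.
exists L; last by move=> x; split=> /LP.
split; first by apply/LP; exists 0%N.
(* The opposite of d *+ j is d *+ (j * (n - 1)). *)
move=> _ _ /LP[i ->] /LP[j ->]; apply/LP; exists (i + j * n.-1)%N.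
rewrite mulrnDr; congr (_ + _); apply/eqP; rewrite eq_sym -addr_eq0 -mulrnDr.
by rewrite addnC -mulnS prednK // mulnC mulrnA dn mul0rn.
Qed.

Lemma translate_multiple S d i : translate S d = S -> translate S (d *+ i) = S.
Proof.
move=> Sd; elim: i => [|i IH]; apply/fsetP=> y; rewrite in_translate.
  by rewrite subr0.
by rewrite mulrSr opprD addrA -in_translate Sd -in_translate IH.
Qed.

Lemma stable_cyclic_subgroup S d : S != fset0 -> translate S d = S ->
  exists2 L : {fset G}, subgroup L /\ d \in L &
    {in L, forall x, translate S x = S}.
Proof.
move=> /fset0Pn[s sS] Sd.
have [i _|i [j [ij _]]] := @pigeonhole S (fun i => s + d *+ i).
  by rewrite -(translate_multiple i Sd) in_translate addrK.
move/addrI => e.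
have [||L sL LP] := @cyclic_subgroup d (j - i); first by rewrite subn_gt0.
  by rewrite mulrnBr ?e ?subrr // ltnW.
exists L; first by split=> //; apply/LP; exists 1%N.
by move=> x /LP[k ->]; apply: translate_multiple.
Qed.

Lemma card_subgroup_gt1 L x :
  subgroup L -> x \in L -> x != 0 -> (2 <= #|` L|)%N.
Proof.
move=> [L0 _] xL x0; have := cardfs2 0 x; rewrite eq_sym x0 => <-.
by apply: fsubset_leq_card; rewrite fsubUset !fsub1set L0.
Qed.

(** Walking backwards from [e] by steps of [d], one has to leave [S]: otherwise
    [d] has finite order and the walk returns to [e + d], which is not in [S].
    The elements [C] visited before leaving form a progression, and the rest
    of [S] is closed under adding [d], because a step into [C] can only come
    from [C]. *)
Lemma terminal_progression S d e : d != 0 -> e \in S -> e + d \notin S ->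
  {in S, forall s, s != e -> s + d \in S} ->
  exists C, [/\ e \in C, C `<=` S, arithmetic_progression C,
    {in C, forall y, exists i, y = e - d *+ i} &
    translate (S `\` C) d = S `\` C].
Proof.
move=> d0 eS edS Sd.
have exS : exists k, e - d *+ k \notin S.
  apply: contrapT => h.
  have [i _|i [j [ij _ /addrI/oppr_inj]]] :=
    @pigeonhole S (fun i => e - d *+ i).
    by apply: contraT => eiS; case: h; exists i.
  move=> dij; apply: h; exists (j - i).-1; apply: contra edS.
  suff -> : e + d = e - d *+ (j - i).-1 by [].
  congr (e + _); apply/eqP; rewrite -addr_eq0 -mulrS prednK ?subn_gt0 //.
  by rewrite mulrnBr ?dij ?subrr // ltnW.
case: (ex_minnP exS) => k kS kmin.
have inS i : (i < k)%N -> e - d *+ i \in S.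
  by move=> ik; apply: contraT => /kmin; lia.
have k1 : (0 < k)%N by case: k kS {kmin inS} => //; rewrite subr0 eS.
pose C := [fset e - d *+ i | i in iota 0 k].
have CP y : reflect (exists2 i, (i < k)%N & y = e - d *+ i) (y \in C).
  by apply: (iffP (imfsetP _ _ _ _)) => /= -[i ik ->]; exists i => //;
    move: ik; rewrite mem_iota.
exists C; split.
- by apply/CP; exists 0%N; rewrite ?subr0.
- by apply/fsubsetP=> _ /CP[i ik ->]; apply: inS.
- exists (e - d *+ k), d, k; split=> //.
    move=> n n0 dn; rewrite leqNgt; apply/negP=> nk; move/negP: edS; apply.
    suff -> : e + d = e - d *+ n.-1 by apply: inS; lia.
    congr (e + _); apply/eqP; rewrite -addr_eq0 -mulrS prednK //.
    by rewrite dn.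
  apply/fsetP=> y; apply/CP/imfsetP => /= -[i].
    move=> ik ->; exists (k - i)%N; first by rewrite mem_iota; lia.
    by rewrite mulrnBr ?(ltnW ik) // addrA subrK.
  rewrite mem_iota => ik ->; exists (k - i)%N; first by lia.
  by rewrite mulrnBr 1?opprB 1?addrA 1?addrAC //; lia.
- by move=> _ /CP[i _ ->]; exists i.
apply/eqP; rewrite eqEfcard card_translate leqnn andbT.
apply/fsubsetP=> y; rewrite in_translate !inE => /andP[ydC ydS].
have yde : y - d != e.
  by apply: contra ydC => /eqP->; apply/CP; exists 0%N; rewrite ?subr0.
have := Sd _ ydS yde; rewrite subrK => yS; rewrite yS andbT.
apply: contra ydC => /CP[i ik ey].
have eyd : y - d = e - d *+ i.+1 by rewrite ey mulrSr opprD addrA.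
have [ik'|] := ltnP i.+1 k; first by apply/CP; exists i.+1.
move=> ki; have eki : i.+1 = k by apply/eqP; rewrite eqn_leq ki ik.
by move: kS; rewrite -eki -eyd ydS.
Qed.

(** The atom [{0, d}].  Only one element [e] of [S], if any, has [e + d] outside
    [S]; [S] is then the union of the progression ending at [e] and of cosets
    of the subgroup generated by [d]. *)
Lemma pair_atom S d : S != fset0 -> d != 0 ->
  (#|` translate S d `\` S| <= 1)%N ->
  at_least (predT : {pred G}) (2 * #|` S| - 1) ->
  (exists x, x \notin S) ->
  arithmetic_progression S \/
  exists2 L, tight_subgroup S L & (2 <= #|` L|)%N.
Proof.
move=> S0 d0 cSd bS outS.
have [Sd0|/fset0Pn[e']] := eqVneq (translate S d `\` S) fset0.
  have Sd : translate S d = S.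
    apply/eqP; rewrite eqEfcard card_translate leqnn andbT.
    by rewrite -fsetD_eq0 Sd0.
  have [L [sL dL] per] := stable_cyclic_subgroup S0 Sd.
  right; exists L; last exact: card_subgroup_gt1 sL dL d0.
  have SL : sumset S L = S.
    apply/eqP; rewrite eqEfcard card_sumset_ge ?andbT.
      apply/fsubsetP=> _ /sumsetP[s sS [l /per <- ->]].
      by rewrite in_translate addrK.
    by apply/fset0Pn; exists d.
  split=> //; rewrite ?SL //.
  have := card_subgroup_gt1 sL dL d0; lia.
rewrite inE in_translate => /andP[e'S eS].
pose e := e' - d.
have edS : e + d \notin S by rewrite subrK.
have Sd : {in S, forall s, s != e -> s + d \in S}.
  move=> s sS se; apply: contraT => sdS.
  have /fsubset_leq_card : [fset e'; s + d] `<=` translate S d `\` S.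
    by rewrite fsubUset !fsub1set !inE !in_translate addrK e'S eS sdS sS.
  by rewrite cardfs2 -(inj_eq (addIr (- d))) addrK eq_sym se; lia.
have [C [eC CS apC CP per]] := terminal_progression d0 eS edS Sd.
have [D0|D0] := eqVneq (S `\` C) fset0.
  left; suff <- : C = S by [].
  by apply/eqP; rewrite eqEfsubset CS -fsetD_eq0 D0 /=.
right; have [L [sL dL] perL] := stable_cyclic_subgroup D0 per.
exists L; last exact: card_subgroup_gt1 sL dL d0.
have [||cSL outSL] := @almost_periodic _ L S C e sL CS _ _ perL.
- by apply/fset0Pn; exists e.
- move=> _ /CP[i ->]; rewrite addrAC subrr add0r; apply: subgroupN => //.
  elim: i => [|i IH]; first by case: sL.
  by rewrite mulrS subgroupD.
by split=> //; apply: outSL.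
Qed.

(** The Sidon atom.  Unless [S + K] is contained in [M + S], some coset [s + K]
    is not filled by [C + M], where [C] is the part of [S] in it.  Then
    [C + M] already has at least [|C| + |M| - 1] elements, so the disjoint set
    [(S `\` C) + M] has no more elements than [S `\` C]: every element of [M]
    is a period of [S `\` C], and by minimality of [K] so is every element of
    [K]. *)
Lemma sidon_atom S M : (2 <= #|` S|)%N -> sidon M -> 0 \in M ->
  (3 <= #|` M|)%N -> (#|` sumset M S| < #|` M| + #|` S|)%N ->
  at_least (predT : {pred G}) (#|` sumset M S| + 2) ->
  at_least (predT : {pred G}) (2 * #|` S| - 1) ->
  exists2 L, tight_subgroup S L & (2 <= #|` L|)%N.
Proof.
move=> S2 siM M0 M3 cMS bMS bS.
have nM : M != fset0 by apply/fset0Pn; exists 0.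
have nS : S != fset0 by rewrite -cardfs_gt0; lia.
have sS : separating predT M 2 S by split=> //; rewrite sumsetC.
have [|N [[_ N2 bN] N0 cN dich]] := two_atom_exists (c := #|` M| - 1) nM sS.
  by rewrite sumsetC; lia.
have sN : subgroup N.
  case: dich => // siN; have := sidon_sumset siM siN M3 N2.
  by rewrite sumsetC; lia.
have MN : M `<=` N.
  by apply: sidon_sub_subgroup => //; rewrite sumsetC; lia.
pose P k := `[< exists K, [/\ subgroup K, M `<=` K & #|` K| = k] >].
have exP : exists k, P k by exists #|` N|; apply/asboolP; exists N.
case: (ex_minnP exP) => k /asboolP[K [sK MK cK]] kmin.
have Kmin Q : subgroup Q -> M `<=` Q -> (#|` K| <= #|` Q|)%N.
  by move=> sQ MQ; rewrite cK; apply: kmin; apply/asboolP; exists Q.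
have cMK := fsubset_leq_card MK.
exists K; last by lia.
have [full|] :=
  pselect (forall s x, s \in S -> x \in K -> s + x \in sumset M S).
  have SK : (#|` sumset S K| <= #|` sumset M S|)%N.
    apply/fsubset_leq_card/fsubsetP=> _ /sumsetP[s sS' [x xK ->]].
    exact: full.
  split=> //; first by lia.
  by apply: at_least_out bMS _; lia.
move=> nfull.
have [s sS' [x xK sxMS]] : exists2 s, s \in S &
    exists2 x, x \in K & s + x \notin sumset M S.
  apply: contrapT => h; apply: nfull => s x sS' xK; apply: contraT => sx.
  by case: h; exists s => //; exists x.
pose C := [fset y in S | y - s \in K].
have CS : C `<=` S by apply/fsubsetP=> y; rewrite !inE => /andP[].
have sC : s \in C by rewrite !inE sS' subrr; case: sK.
have nC : C != fset0 by apply/fset0Pn; exists s.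
have CK : {in C, forall y, y - s \in K} by move=> y; rewrite !inE => /andP[].
have cCM : (#|` C| + #|` M| <= #|` sumset C M| + 1)%N.
  have := @sidon_sumset_minimal _ M K (translate C (- s))
    siM M0 (ltnW M3) sK MK Kmin.
  rewrite card_sumset_translate card_translate; apply.
  - by rewrite -cardfs_gt0 card_translate cardfs_gt0.
  - by apply/fsubsetP=> y; rewrite in_translate opprK => /CK; rewrite addrK.
  apply: contra sxMS => /fsubsetP/(_ _ xK).
  rewrite sumset_translate in_translate opprK addrC.
  by rewrite (sumsetC M S); apply/fsubsetP/sumsetSl.
have dis : sumset C M `&` sumset (S `\` C) M = fset0.
  apply/fsetP=> z; rewrite !inE; apply/negP=> /andP[].
  move=> /sumsetP[y yC [m mM ->]] /sumsetP[y' + [m' m'M e]].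
  rewrite !inE => /andP[/negP + y'S]; apply; rewrite y'S /=.
  have -> : y' - s = (y - s) + (m - m').
    by rewrite addrACA e addrACA subrr addr0.
  have /fsubsetP MK' := MK.
  by apply: subgroupD; rewrite ?CK //; apply: (proj2 sK); apply: MK'.
have cD : (#|` sumset (S `\` C) M| <= #|` S `\` C|)%N.
  have := cardfsUI (sumset C M) (sumset (S `\` C) M).
  have -> : sumset C M `|` sumset (S `\` C) M = sumset M S.
    by rewrite -sumsetUl sumsetC -{1}(fsetIidPr CS) fsetID.
  rewrite dis cardfs0 addn0 => cU; rewrite cardfsD (fsetIidPr CS).
  have cC := fsubset_leq_card CS.
  by clear - cU cC cCM cMS; lia.
have DM : sumset (S `\` C) M = S `\` C.
  apply/eqP; rewrite eq_sym eqEfcard cD andbT.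
  by apply/fsubsetP=> y yD; rewrite -(addr0 y) mem_sumset.
have perM m : m \in M -> translate (S `\` C) m = S `\` C.
  move=> mM; apply/eqP; rewrite eqEfcard card_translate leqnn andbT.
  by rewrite -{2}DM translate_sub.
(* The periods of S `\` C in K form a subgroup that contains M. *)
pose Q := [fset y in K | translate (S `\` C) y == S `\` C].
have QP y : (y \in Q) = (y \in K) && (translate (S `\` C) y == S `\` C).
  by rewrite !inE.
have tD T a b :
  translate T a = T -> translate T b = T -> translate T (a - b) = T.
  move=> Ta Tb; apply/fsetP=> z.
  by rewrite in_translate opprB addrA -in_translate Ta -{1}Tb in_translate addrK.
have sQ : subgroup Q.
  split.
    rewrite QP (proj1 sK) /=; apply/eqP/fsetP=> z.
    by rewrite in_translate subr0.
  move=> a b; rewrite !QP => /andP[aK /eqP aD] /andP[bK /eqP bD].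
  by rewrite (proj2 sK) //= tD.
have MQ : M `<=` Q.
  apply/fsubsetP=> m mM; rewrite QP perM // eqxx andbT.
  by move/fsubsetP: MK; apply.
have QK : Q = K.
  apply/eqP; rewrite eqEfcard Kmin // andbT.
  by apply/fsubsetP=> y; rewrite QP => /andP[].
have perK : {in K, forall y, translate (S `\` C) y = S `\` C}.
  by move=> y; rewrite -QK QP => /andP[_ /eqP].
have [cSK outSK] := almost_periodic sK CS nC CK perK.
split=> //; have [D0|/outSK] := eqVneq (S `\` C) fset0; last exact.
apply: at_least_out bN _.
have : sumset S K `<=` translate K s.
  apply/fsubsetP=> _ /sumsetP[y yS [z zK ->]]; rewrite in_translate addrAC.
  apply: subgroupD => //; apply: CK; move/eqP: D0; rewrite fsetD_eq0.
  by move/fsubsetP; apply.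
move/fsubset_leq_card; rewrite card_translate => cSKK.
by rewrite addn2 ltnS leqW // (leq_trans cSKK) // (leq_trans (Kmin N sN MN)) //
  card_sumset_ge.
Qed.

Lemma card1_progression S : #|` S| = 1%N -> arithmetic_progression S.
Proof.
move=> /eqP/cardfs1P[x ->]; exists x, 0, 1%N; split=> //.
apply/fsetP=> y; rewrite in_fset1; apply/eqP/imfsetP=> /= [->|[i _ ->]].
  by exists 1%N; rewrite ?mem_iota // mul0rn addr0.
by rewrite mul0rn addr0.
Qed.

(** In contrast to thickness, this concerns one set [B]: a single failure of
    [|S + B| >= |S| + |B|], away from the trivial range, already determines the
    coarse structure of [S]. *)
Theorem critical_pair S B : S != fset0 -> (2 <= #|` B|)%N ->
  (#|` sumset S B| < #|` S| + #|` B|)%N ->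
  at_least (predT : {pred G}) (#|` S| + #|` B| + 2) ->
  at_least (predT : {pred G}) (2 * #|` S| - 1) ->
  arithmetic_progression S \/
  exists2 L, tight_subgroup S L & (2 <= #|` L|)%N.
Proof.
move=> nS B2 cSB bSB bS.
have [S1|S1] := eqVneq #|` S| 1%N; first by left; apply: card1_progression.
have S0 : (0 < #|` S|)%N by rewrite cardfs_gt0.
have S2 : (2 <= #|` S|)%N by rewrite ltn_neqAle eq_sym S1.
have sB : separating predT S 2 B.
  by split=> //; apply: at_leastW bSB; rewrite sumsetC; lia.
have [|M [[_ M2 bM] M0 cM dich]] := two_atom_exists (c := #|` S| - 1) nS sB.
  by rewrite sumsetC; lia.
have nM : M != fset0 by apply/fset0Pn; exists 0.
case: dich => [sM|siM].
  right; exists M => //; split=> //; first by rewrite sumsetC; lia.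
  by apply: at_least_out bM _; rewrite sumsetC; lia.
have [cM2|M3] := eqVneq #|` M| 2; last first.
  right; apply: (@sidon_atom S M) => //; last by lia.
  by rewrite ltn_neqAle eq_sym M3.
have [d] : exists d, d \in M `\ 0.
  by apply/fset0Pn; rewrite -cardfs_gt0; move: M2; rewrite (cardfsD1 0) M0.
rewrite !inE => /andP[d0 dM].
apply: (@pair_atom S d) => //.
  have /fsubset_leq_card : S `|` translate S d `<=` sumset M S.
    rewrite sumsetC fsubUset translate_sub // andbT.
    by apply/fsubsetP=> y yS; rewrite -(addr0 y) mem_sumset.
  have := cardfsD (translate S d) S; have := cardfsUI S (translate S d).
  by rewrite card_translate fsetIC; lia.
by apply: at_least_out bM _; have := card_sumset_ge S nM; rewrite sumsetC; lia.
Qed.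

End CriticalPair.

(** * Comparison with cardinals *)

Section Cardinals.
Variable G : zmodType.

Lemma at_least_card n :
  (`I_n #<= [set: G])%classic -> at_least (predT : {pred G}) n.
Proof.
move=> nG; apply: contrapT => /at_leastN[W WT Wn].
have e : [set: G]%classic = [set` W]%classic.
  by apply/seteqP; split=> // x _ /=; rewrite WT.
move: nG; rewrite e (card_le_eqr (_ : [set` W]%classic #= `I_#|` W|%classic)).
  by rewrite card_le_II; lia.
exact/card_eq_fsetP.
Qed.

Lemma at_least_cardN n :
  ~ ([set: G] #<= `I_n)%classic -> at_least (predT : {pred G}) n.+1.
Proof.
move=> nG; apply: contrapT => /at_leastN[W WT Wn]; apply: nG.
have -> : [set: G]%classic = [set` W]%classic.
  by apply/seteqP; split=> // x _ /=; rewrite WT.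
rewrite (card_le_eql (_ : [set` W]%classic #= `I_#|` W|%classic)).
  by rewrite card_le_II.
exact/card_eq_fsetP.
Qed.

End Cardinals.

(** * Passing to the quotient *)

(** The proof [sK] is an argument so that the closedness instance can be
    inferred from the term itself. *)
Definition subgroup_pred (G : zmodType) (K : {fset G}) (sK : subgroup K) :
  {pred G} := [pred x in K].

HB.instance Definition _ (G : zmodType) (K : {fset G}) (sK : subgroup K) :=
  GRing.isZmodClosed.Build G (subgroup_pred sK) sK.

Section Quotients.
Variables (G : zmodType) (K : {fset G}) (sK : subgroup K).
Let H : zmodClosed G := subgroup_pred sK.
Let Q := Quotient.quot H.
Implicit Types (A L : {fset G}) (X Y : {fset Q}).

Let cls (x : G) : Q := \pi_(Q)%qT x.

Lemma clsP x y : reflect (cls x = cls y) (x - y \in K).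
Proof.
have -> : (x - y \in K) = (cls x == cls y) := Quotient.idealrBE H x y.
exact: eqP.
Qed.

Lemma clsD x y : cls (x + y) = cls x + cls y.
Proof. exact: Quotient.pi_add. Qed.

Definition fiber X : {fset G} :=
  [fset y in [seq repr x + k | x <- X, k <- K]].

Lemma in_fiber X y : (y \in fiber X) = (cls y \in X).
Proof.
rewrite inE; apply/allpairsP/idP => /= [[[x k] /= [xX kK ->]]|yX].
  suff -> : cls (repr x + k) = x by [].
  by rewrite -[RHS]reprK; apply/clsP; rewrite addrAC subrr add0r.
exists (cls y, y - repr (cls y)); split=> //=; last by rewrite addrC subrK.
by apply/clsP; rewrite /cls reprK.
Qed.

Lemma card_fiber X : #|` fiber X| = (#|` X| * #|` K|)%N.
Proof.
rewrite card_fseq undup_id ?size_allpairs //.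
apply: allpairs_uniq; rewrite ?fset_uniq // => -[x k] [x' k'].
case/allpairsP=> -[? ?] /= [_ + [_ e1]]; rewrite -{}e1 => kK.
case/allpairsP=> -[? ?] /= [_ + [_ e1]]; rewrite -{}e1 => k'K e.
suff xx' : x = x' by move: e; rewrite xx' => /addrI->.
rewrite -[x]reprK -[x']reprK; apply/clsP.
have -> : repr x - repr x' = k' - k.
  by apply/eqP; rewrite subr_eq addrAC [k' + _]addrC -e addrK.
exact: (proj2 sK).
Qed.

Lemma in_quot_image A y : (cls y \in quot_image H A) = (y \in sumset A K).
Proof.
apply/imfsetP/sumsetP=> /= [[a aA /clsP yaK]|[a aA [k kK ->]]].
  by exists a => //; exists (y - a) => //; rewrite addrC subrK.
by exists a => //; apply/clsP; rewrite addrAC subrr add0r.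
Qed.

Lemma fiber_quot_image A : fiber (quot_image H A) = sumset A K.
Proof. by apply/fsetP=> y; rewrite in_fiber in_quot_image. Qed.

Lemma sumset_fiber A X : sumset A (fiber X) = fiber (sumset (quot_image H A) X).
Proof.
apply/fsetP=> y; rewrite in_fiber; apply/sumsetP/sumsetP.
  move=> [a aA [b + ->]]; rewrite in_fiber => bX.
  exists (cls a); first by apply/imfsetP; exists a.
  by exists (cls b); rewrite ?clsD.
move=> [_ /imfsetP[/= a aA ->] [x xX e]].
exists a => //; exists (y - a); last by rewrite addrC subrK.
rewrite in_fiber; suff -> : cls (y - a) = x by [].
by apply: (addrI (cls a)); rewrite -clsD addrC subrK.
Qed.

Lemma subgroup_fiber X : subgroup X -> subgroup (fiber X).
Proof.
move=> [X0 XB]; split.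
  rewrite in_fiber; suff -> : cls 0 = 0 by [].
  by apply: (addrI (cls 0)); rewrite -clsD !addr0.
move=> x y; rewrite !in_fiber => xX yX.
suff -> : cls (x - y) = cls x - cls y by apply: XB.
by apply: (addIr (cls y)); rewrite -clsD !subrK.
Qed.

Lemma card_quot_image A : (#|` quot_image H A| * #|` K| = #|` sumset A K|)%N.
Proof. by rewrite -card_fiber fiber_quot_image. Qed.

(** Passing to the quotient may lose the bound [2 |A| <= |G|] only by one: [A]
    fills its [K]-cosets up to at most [|K| - 1] elements. *)
Lemma at_least_quot A : (#|` sumset A K| < #|` A| + #|` K|)%N ->
  at_least (predT : {pred G}) (2 * #|` A|) ->
  at_least (predT : {pred Q}) (2 * #|` quot_image H A| - 1).
Proof.
move=> cAK [X _ AX]; apply: contrapT => /at_leastN[W WT cW].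
have /fsubset_leq_card : X `<=` fiber W.
  by apply/fsubsetP=> x _; rewrite in_fiber WT.
rewrite card_fiber => /(leq_trans AX) AW.
have count (a k i w : nat) :
  (i * k < a + k -> w < 2 * i - 1 -> 2 * a <= w * k -> False)%N.
  by clear; nia.
by apply: count cW AW; rewrite card_quot_image.
Qed.

(** Multiplying [|A' + X| <= |A'| + |X| - 1] by [|K|], where [A'] is the image
    of [A], gives [|A + fiber X| <= |A + K| + |fiber X| - |K|], and the right
    side is less than [|A| + |fiber X|] because [K] is tight. *)
Lemma tight_fiber A X :
  tight_subgroup A K -> tight_subgroup (quot_image H A) X ->
  tight_subgroup A (fiber X).
Proof.
move=> [_ cAK _] [sX cAX [x]]; rewrite -[x]reprK => xAX.
split; first exact: subgroup_fiber.
  rewrite sumset_fiber !card_fiber.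
  have count (a k i l m : nat) :
    (i * k < a + k -> m < i + l -> m * k < a + l * k)%N by clear; nia.
  by apply: count cAX; rewrite card_quot_image.
by exists (repr x); rewrite sumset_fiber in_fiber.
Qed.

End Quotients.

Theorem theorem3 (G : zmodType) (A : {fset G}) :
  A != fset0 ->
  (`I_(2 * #|` A|) #<= [set: G])%classic ->
  exists (H : zmodClosed G) (K : {fset G}),
    [/\ K =i H,
        (exists x : G, x \notin H),
        (#|` sumset A K| - #|` A| <= #|` K| - 1)%N,
        [set` sumset A K]%classic <> [set: G]%classic &
        arithmetic_progression (quot_image H A) \/
        thick_component (quot_image H A)].
Proof.
move=> nA /at_least_card cG.
have A0 : (0 < #|` A|)%N by rewrite cardfs_gt0.
suff [K [sK [[_ cAK [x xAK]] Kdich]]] : exists (K : {fset G}) (sK : subgroup K),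
    tight_subgroup A K /\
    (arithmetic_progression (quot_image (subgroup_pred sK) A) \/
     thick_component (quot_image (subgroup_pred sK) A)).
  exists (subgroup_pred sK : zmodClosed G), K; split=> //.
  - case/fset0Pn: nA => a aA; exists (x - a); apply: contra xAK => xaK.
    by rewrite -(subrK a x) addrC mem_sumset.
  - lia.
  - by move=> /seteqP[_ /(_ x I)] /=; apply/negP.
have nonempty K (sK : subgroup K) :
    quot_image (subgroup_pred sK) A != fset0.
  case/fset0Pn: nA => a aA; apply/fset0Pn.
  exists (\pi_(Quotient.quot (subgroup_pred sK))%qT a).
  by apply/imfsetP; exists a.
(* A tight subgroup larger than A forces A into one of its cosets; once these
   are excluded, the sizes of tight subgroups are bounded, even when G is
   infinite. *)
have [[K tK cK]|small] :=
  pselect (exists2 K, tight_subgroup A K & (#|` A| < #|` K|)%N).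
  have [sK cAK _] := tK; exists K, sK; split=> //.
  left; apply: card1_progression.
  have count (a k i : nat) :
    (0 < i -> a < k -> i * k < a + k -> i = 1)%N by clear; nia.
  apply: count cK _; first by rewrite cardfs_gt0; exact: nonempty.
  by rewrite card_quot_image.
pose P k := `[< exists2 K, tight_subgroup A K & #|` K| = k >].
have exP : exists k, P k.
  exists 1%N; apply/asboolP; exists [fset 0]; last by rewrite cardfs1.
  have A1 : sumset A [fset 0] = A.
    apply/eqP; rewrite eq_sym eqEfcard; apply/andP; split.
      by apply/fsubsetP=> a aA; rewrite -(addr0 a) mem_sumset ?in_fset1.
    rewrite sumsetC; apply/fsubset_leq_card/fsubsetP.
    move=> _ /sumsetP[y + [a aA ->]].
    by rewrite in_fset1 => /eqP->; rewrite add0r.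
  split.
  - split; first by rewrite in_fset1.
    by move=> x y; rewrite !in_fset1 => /eqP-> /eqP->; rewrite subr0.
  - by rewrite A1 cardfs1 addn1.
  - by rewrite A1; apply: at_least_out cG _; lia.
have ubP k : P k -> (k <= #|` A|)%N.
  move=> /asboolP[K tK <-]; rewrite leqNgt; apply/negP=> cK.
  by apply: small; exists K.
case: (ex_maxnP exP ubP) => _ /asboolP[K tK <-] Kmax.
have [sK cAK _] := tK; exists K, sK; split=> //.
apply: contrapT => /not_orP[nAP nthick].
have [B [B2 cAB bAB]] : exists B : {fset Quotient.quot (subgroup_pred sK)},
  [/\ (2 <= #|` B|)%N,
    (#|` sumset (quot_image (subgroup_pred sK) A) B| <
     #|` quot_image (subgroup_pred sK) A| + #|` B|)%N &
    ~ ([set: Quotient.quot (subgroup_pred sK)] #<=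
       `I_(#|` quot_image (subgroup_pred sK) A| + #|` B| + 1))%classic].
  apply: contrapT => h; apply: nthick; split; first exact: nonempty.
  move=> B B2; apply: contrapT => /not_orP[/negP c1 c2].
  by apply: h; exists B; split=> //; rewrite ltnNge.
have [] // := critical_pair _ B2 cAB _ (at_least_quot sK cAK cG).
- exact: nonempty.
- by have := at_least_cardN bAB; rewrite -addn1 -addnA.
move=> [L tL L2].
have /Kmax : P #|` (@fiber _ _ sK L)|.
  by apply/asboolP; exists (@fiber _ _ sK L) => //; apply: tight_fiber.
have : (0 < #|` K|)%N.
  by rewrite cardfs_gt0; apply/fset0Pn; exists 0; exact: (proj1 sK).
rewrite card_fiber => K0 LK.
have count (k l : nat) : (0 < k -> 2 <= l -> l * k <= k -> False)%N.
  by clear; nia.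
exact: count K0 L2 LK.
Qed.
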